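(* Let $k$ be a field and let $A=\bigoplus_{n\ge 0}A^n$ be a finite dimensional graded $k$-algebra with $A^0=k$ and such that $\overline{A}=\bigoplus_{n\ge 1}A^n$ is not zero. Assume that there exist two generators $x$ and $y$ of the algebra $A$ satisfying $xy=yx=0$. Then the total Hochschild homology $\bigoplus_{p\ge 0}HH_p(A)$ of $A$ is not finite dimensional over $k$.
   Context: All algebras are associative and unital over the field $k$ (of arbitrary characteristic). The Hochschild homology is $HH_p(A)=\mathrm{Tor}_p^{A^e}(A,A)$ with $A^e=A\otimes_k A^{op}$, where $A$ is regarded as an ordinary (ungraded) $k$-algebra. Convention on generators: elements $x_1,\dots,x_r\in\overline{A}$ are called generators of $A$ if their images in $\overline{A}/\overline{A}^2$ form a basis of this vector space; ''two generators $x$ and $y$ of $A$'' means two distinct members of such a family (equivalently, $x,y\in\overline{A}$ have linearly independent images in $\overline{A}/\overline{A}^2$). *)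

(* Defs.v *)
From HB Require Import structures.
From mathcomp Require Import all_boot all_algebra all_field.
From mathcomp Require Import boolp.
From mathcomp.multinomials Require Import freeg.

Set Implicit Arguments.
Unset Strict Implicit.
Unset Printing Implicit Defensive.

Import GRing.Theory.
Local Open Scope ring_scope.
Local Open Scope quotient_scope.

Section Free.
Variables (R : nzRingType) (X : choiceType).

Definition free_mod := {freeg X / R}.
HB.instance Definition _ := GRing.Lmodule.on free_mod.

Definition fgen (x : X) : free_mod := Freeg [:: (1, x)].

Section Lift.
Variables (M : lmodType R) (f : X -> M).

Definition flift : free_mod -> M := fglift f.

Lemma flift_is_zmod_morphism : zmod_morphism flift.
Proof. exact: lift_is_additive. Qed.
HB.instance Definition _ :=
  GRing.isZmodMorphism.Build free_mod M flift flift_is_zmod_morphism.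

Lemma flift_is_scalable : scalable flift.
Proof.
move=> a D; rewrite -[a *: D]/(fgscale a D) /fgscale.
rewrite -[in RHS](freeg_sumE D) !raddf_sum.
by apply: eq_bigr => x _; rewrite /= /flift !liftU scalerA.
Qed.
HB.instance Definition _ :=
  GRing.isScalable.Build R free_mod M _ flift flift_is_scalable.

Lemma flift_gen x : flift (fgen x) = f x.
Proof. by rewrite /flift liftU scale1r. Qed.

End Lift.

Lemma free_sum (D : free_mod) :
  D = \sum_(x <- dom D) coeff x D *: fgen x.
Proof.
rewrite -[LHS]freeg_sumE; apply: eq_bigr => x _.
apply/eqP/freeg_eqP => y.
by rewrite coeffZ !coeffU mulrA mulr1.
Qed.

Lemma free_ext (M : lmodType R) (f g : {linear free_mod -> M}) :
  (forall x, f (fgen x) = g (fgen x)) -> f =1 g.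
Proof.
move=> fg D; rewrite (free_sum D) !linear_sum.
by apply: eq_bigr => x _; rewrite !linearZ /= fg.
Qed.

End Free.

Section Quot.
Variables (R : nzRingType) (V : lmodType R) (S : V -> Prop).

Definition in_span (v : V) := exists s : seq (R * V),
  (forall p, p \in s -> S p.2) /\ v = \sum_(p <- s) p.1 *: p.2.

Definition spanp : {pred V} := fun v => `[< in_span v >].

Lemma spanpP v : reflect (in_span v) (v \in spanp).
Proof. exact: asboolP. Qed.

Lemma spanp_scale a v : v \in spanp -> a *: v \in spanp.
Proof.
move=> /spanpP [s [sS ->]]; apply/spanpP.
exists [seq (a * p.1, p.2) | p <- s]; split.
  by move=> _ /mapP [p ps ->]; exact: (sS p ps).
by rewrite big_map scaler_sumr; apply: eq_bigr => p _; rewrite scalerA.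
Qed.

Lemma spanp_zmod_closed : zmod_closed spanp.
Proof.
split; first by apply/spanpP; exists [::]; split=> //; rewrite big_nil.
move=> u v /spanpP [s [sS ->]] /(spanp_scale (-1)); rewrite scaleN1r.
move=> /spanpP [t [tS ->]]; apply/spanpP; exists (s ++ t); split.
  by move=> p; rewrite mem_cat => /orP [/sS|/tS].
by rewrite big_cat.
Qed.
HB.instance Definition _ := GRing.isZmodClosed.Build V spanp spanp_zmod_closed.

Lemma spanp_mem v : S v -> v \in spanp.
Proof.
move=> Sv; apply/spanpP; exists [:: (1, v)]; split.
  by move=> p; rewrite inE => /eqP ->.
by rewrite big_seq1 scale1r.
Qed.

Definition mquot := Quotient.quot spanp.

HB.instance Definition _ := GRing.Zmodule.on mquot.
HB.instance Definition _ := EqQuotient.on mquot.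

Definition qpi (v : V) : mquot := \pi_(Quotient.quot spanp) v.

Lemma qpi_is_zmod_morphism : zmod_morphism qpi.
Proof. by move=> u v; rewrite /qpi raddfB. Qed.
HB.instance Definition _ :=
  GRing.isZmodMorphism.Build V mquot qpi qpi_is_zmod_morphism.

Lemma qpi_eq u v : (qpi u == qpi v) = (u - v \in spanp).
Proof. by rewrite /qpi Quotient.idealrBE. Qed.

Lemma qpi_eq0 v : (qpi v == 0) = (v \in spanp).
Proof. by rewrite -(raddf0 qpi) qpi_eq subr0. Qed.

Lemma qpi_repr (q : mquot) : qpi (repr (q : Quotient.quot spanp)) = q.
Proof. exact: reprK. Qed.

Definition mquot_scale (a : R) (q : mquot) : mquot :=
  qpi (a *: repr (q : Quotient.quot spanp)).

Lemma mquot_scale_pi a v : mquot_scale a (qpi v) = qpi (a *: v).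
Proof.
apply/eqP; rewrite qpi_eq -scalerBr spanp_scale // -qpi_eq qpi_repr.
exact: eqxx.
Qed.

Fact mquot_scaleA a b q :
  mquot_scale a (mquot_scale b q) = mquot_scale (a * b) q.
Proof. by rewrite -(qpi_repr q) !mquot_scale_pi scalerA. Qed.
Fact mquot_scale1 : left_id 1 mquot_scale.
Proof. by move=> q; rewrite -(qpi_repr q) mquot_scale_pi scale1r. Qed.
Fact mquot_scaleDr : right_distributive mquot_scale +%R.
Proof.
move=> a p q; rewrite -(qpi_repr p) -(qpi_repr q).
by rewrite -raddfD !mquot_scale_pi scalerDr raddfD.
Qed.
Fact mquot_scaleDl q : {morph mquot_scale^~ q : a b / a + b}.
Proof.
by move=> a b; rewrite -(qpi_repr q) !mquot_scale_pi scalerDl raddfD.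
Qed.
HB.instance Definition _ := GRing.Zmodule_isLmodule.Build R mquot
  mquot_scaleA mquot_scale1 mquot_scaleDr mquot_scaleDl.

Lemma qpi_is_scalable : scalable qpi.
Proof. by move=> a v; rewrite -mquot_scale_pi. Qed.
HB.instance Definition _ :=
  GRing.isScalable.Build R V mquot _ qpi qpi_is_scalable.

Section Lift.
Variables (W : lmodType R) (f : {linear V -> W}).
Hypothesis fS : forall v, S v -> f v = 0.

Definition qlift of (forall v, S v -> f v = 0) : mquot -> W :=
  fun q => f (repr (q : Quotient.quot spanp)).
Local Notation F := (qlift fS).

Lemma qlift_pi v : F (qpi v) = f v.
Proof.
apply/eqP; rewrite -subr_eq0 -linearB.
have : repr (qpi v : Quotient.quot spanp) - v \in spanp.
  by rewrite -qpi_eq qpi_repr.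
move=> /spanpP [s [sS ->]]; rewrite linear_sum big_seq big1 // => p ps.
by rewrite linearZ /= fS ?scaler0 //; apply: sS.
Qed.

Lemma qlift_is_linear : linear F.
Proof.
move=> a p q; rewrite -(qpi_repr p) -(qpi_repr q) -linearP !qlift_pi.
exact: linearP.
Qed.
HB.instance Definition _ := GRing.isLinear.Build R mquot W _ F qlift_is_linear.

End Lift.

Lemma qpi_ext (W : lmodType R) (f g : {linear mquot -> W}) :
  (forall v, f (qpi v) = g (qpi v)) -> f =1 g.
Proof. by move=> fg q; rewrite -(qpi_repr q). Qed.

End Quot.

Section Kernel.
Variables (R : nzRingType) (U V : lmodType R) (f : {linear U -> V}).

Definition kerp : {pred U} := fun u => f u == 0.

Fact kerp_submod_closed : submod_closed kerp.
Proof.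
split=> [|a u v]; rewrite !unfold_in ?linear0 // => /eqP fu /eqP fv.
by rewrite linearP fu fv scaler0 addr0.
Qed.
HB.instance Definition _ := GRing.isSubmodClosed.Build R U kerp
  kerp_submod_closed.

Record ker := Ker { ker_val :> U; _ : kerp ker_val }.
HB.instance Definition _ := [isSub for ker_val].
HB.instance Definition _ := [Choice of ker by <:].
HB.instance Definition _ := [SubChoice_isSubLmodule of ker by <:].

Definition ker_incl (z : ker) : U := ker_val z.
Fact ker_incl_is_linear : linear ker_incl. Proof. by []. Qed.
HB.instance Definition _ := GRing.isLinear.Build R ker U _ ker_incl
  ker_incl_is_linear.

Lemma ker_inclP z : f (ker_incl z) = 0.
Proof. by case: z => u /= /eqP. Qed.

End Kernel.

Section TensorField.
Variables (k : fieldType) (V W : lmodType k).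

Inductive bilin_rel : free_mod k (V * W)%type -> Prop :=
| BilinL a v v' w : bilin_rel
    (fgen k (a *: v + v', w) - (a *: fgen k (v, w) + fgen k (v', w)))
| BilinR a v w w' : bilin_rel
    (fgen k (v, a *: w + w') - (a *: fgen k (v, w) + fgen k (v, w'))).

Definition tensk := mquot bilin_rel.
HB.instance Definition _ := GRing.Lmodule.on tensk.

Definition tens (v : V) (w : W) : tensk := qpi bilin_rel (fgen k (v, w)).

Lemma tens_linearl w : linear (tens^~ w).
Proof.
move=> a v v'; apply/eqP; rewrite -linearP qpi_eq.
by apply/spanp_mem/BilinL.
Qed.

Lemma tens_linearr v : linear (tens v).
Proof.
move=> a w w'; apply/eqP; rewrite -linearP qpi_eq.
by apply/spanp_mem/BilinR.
Qed.

Lemma tens_ext (U : lmodType k) (f g : {linear tensk -> U}) :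
  (forall v w, f (tens v w) = g (tens v w)) -> f =1 g.
Proof.
move=> fg; apply: qpi_ext; apply: (@free_ext _ _ _ (f \o qpi _) (g \o qpi _)).
by case.
Qed.

Lemma tens_ind (P : tensk -> Prop) :
  (forall s t, P s -> P t -> P (s + t)) -> (forall v w, P (tens v w)) ->
  forall t, P t.
Proof.
move=> PD Pt t; have P0 : P 0.
  have := Pt 0 0; have := tens_linearl 0 (-1) 0 0.
  by rewrite scaler0 addr0 scaleN1r addNr => ->.
rewrite -(qpi_repr t) (free_sum (repr _)) linear_sum /=.
apply: (big_ind P) => // -[v w] _; rewrite linearZ /=.
have := tens_linearl w (coeff (v, w) (repr t)) v 0.
have := tens_linearl w (-1) 0 0.
rewrite !scaler0 !addr0 scaleN1r addNr => ->.
by rewrite addr0 => <-.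
Qed.

Definition bilinear_map (U : lmodType k) (f : V -> W -> U) :=
  (forall w, linear (f^~ w)) /\ (forall v, linear (f v)).

Section Lift.
Variables (U : lmodType k) (f : V -> W -> U).

Fact tlift_subproof : bilinear_map f ->
  forall u, bilin_rel u -> flift (fun p => f p.1 p.2) u = 0.
Proof.
move=> [fl fr] u [a v v' w|a v w w'].
  by rewrite linearB linearP /= !flift_gen /= fl subrr.
by rewrite linearB linearP /= !flift_gen /= fr subrr.
Qed.

Definition tlift (bf : bilinear_map f) : tensk -> U :=
  qlift (tlift_subproof bf).
HB.instance Definition _ bf := GRing.Linear.on (tlift bf).

Lemma tlift_tens bf v w : tlift bf (tens v w) = f v w.
Proof. by rewrite /tlift qlift_pi /= flift_gen. Qed.

End Lift.

End TensorField.

Section Restriction.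
Variables (k : fieldType) (R : algType k).

Definition restr (M : lmodType R) : Type := M.

Variable M : lmodType R.
HB.instance Definition _ := GRing.Zmodule.on (restr M).

Definition restr_scale (c : k) (m : restr M) : restr M := c%:A *: (m : M).

Fact restr_scaleA a b m :
  restr_scale a (restr_scale b m) = restr_scale (a * b) m.
Proof. by rewrite /restr_scale scalerA -scalerAl mul1r scalerA. Qed.
Fact restr_scale1 : left_id 1 restr_scale.
Proof. by move=> m; rewrite /restr_scale !scale1r. Qed.
Fact restr_scaleDr : right_distributive restr_scale +%R.
Proof. by move=> a m n; rewrite /restr_scale scalerDr. Qed.
Fact restr_scaleDl m : {morph restr_scale^~ m : a b / a + b}.
Proof. by move=> a b; rewrite /restr_scale !scalerDl. Qed.
HB.instance Definition _ := GRing.Zmodule_isLmodule.Build k (restr M)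
  restr_scaleA restr_scale1 restr_scaleDr restr_scaleDl.

End Restriction.

Section Opposite.
Variables (k : fieldType) (A : algType k).

Definition opp_scale (c : k) (a : A^c) : A^c := c *: (a : A).

Fact opp_scaleA a b x : opp_scale a (opp_scale b x) = opp_scale (a * b) x.
Proof. exact: scalerA. Qed.
Fact opp_scale1 : left_id 1 opp_scale.
Proof. exact: scale1r. Qed.
Fact opp_scaleDr : right_distributive opp_scale +%R.
Proof. by move=> a x y; apply: (@scalerDr _ A). Qed.
Fact opp_scaleDl x : {morph opp_scale^~ x : a b / a + b}.
Proof. by move=> a b; apply: (@scalerDl _ A). Qed.
HB.instance Definition _ := GRing.Zmodule_isLmodule.Build k A^c
  opp_scaleA opp_scale1 opp_scaleDr opp_scaleDl.

Fact opp_scaleAl (c : k) (x y : A^c) : c *: (x * y) = (c *: x) * y.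
Proof. exact: (@scalerAr k A). Qed.
HB.instance Definition _ := GRing.Lmodule_isLalgebra.Build k A^c opp_scaleAl.

Fact opp_scaleAr (c : k) (x y : A^c) : c *: (x * y) = x * (c *: y).
Proof. exact: (@scalerAl k A). Qed.
HB.instance Definition _ := GRing.Lalgebra_isAlgebra.Build k A^c opp_scaleAr.

End Opposite.

Section TensorRing.
Variables (k : fieldType) (R : algType k).

Section Def.
Variables (N : lmodType R^c) (M : lmodType R).

(* Right R-modules are encoded as left modules over R^c: (r : R^c) *: n is the
   right action of r on n. *)
Inductive bal_rel : tensk (restr N) (restr M) -> Prop :=
| Bal (n : N) (r : R) (m : M) : bal_rel
    (tens (((r : R^c) *: n : N) : restr N) (m : restr M)
     - tens (n : restr N) ((r *: m : M) : restr M)).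

Definition tensR := mquot bal_rel.
HB.instance Definition _ := GRing.Lmodule.on tensR.

Definition tensr (n : N) (m : M) : tensR :=
  qpi bal_rel (tens (n : restr N) (m : restr M)).

Lemma tensR_ext (U : lmodType k) (f g : {linear tensR -> U}) :
  (forall n m, f (tensr n m) = g (tensr n m)) -> f =1 g.
Proof.
move=> fg; apply: qpi_ext.
by apply: (@tens_ext _ _ _ _ (f \o qpi _) (g \o qpi _)) => n m; apply: fg.
Qed.

End Def.

Section Map.
Variables (N : lmodType R^c) (M M' : lmodType R) (f : {linear M -> M'}).

Let g (n : restr N) (m : restr M) : tensR N M' := tensr (n : N) (f m).

Fact tmap_bilinear : bilinear_map g.
Proof.
split=> [m|n] a x y; rewrite /g /tensr.
  by rewrite tens_linearl linearP.
rewrite -[RHS]linearP -tens_linearr; congr (qpi _ (tens _ _)).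
exact: (linearP f a%:A x y).
Qed.

Fact tmap_balanced u : bal_rel u -> tlift tmap_bilinear u = 0.
Proof.
case=> n r m; rewrite linearB /= !tlift_tens /g linearZ /=.
by apply/eqP; rewrite subr_eq0 /tensr qpi_eq; apply/spanp_mem/Bal.
Qed.

Definition tmap : tensR N M -> tensR N M' := qlift tmap_balanced.
HB.instance Definition _ := GRing.Linear.on tmap.

Lemma tmap_tens n m : tmap (tensr n m) = tensr n (f m).
Proof. by rewrite /tmap qlift_pi /= tlift_tens. Qed.

End Map.
End TensorRing.
Arguments tmap {k R} N {M M'} f.

Record complex (R : nzRingType) := Complex {
  cob :> nat -> lmodType R;
  cdiff : forall n, {linear cob n.+1 -> cob n};
  cdiffK : forall n z, cdiff n (cdiff n.+1 z) = 0
}.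

Section Homology.
Variables (R : nzRingType) (C : complex R).

Definition homology (n : nat) : lmodType R :=
  match n with
  | 0 => mquot (fun z : C 0 => exists w, cdiff C 0 w = z)
  | n.+1 =>
      mquot (fun z : ker (cdiff C n) => exists w, cdiff C n.+1 w = ker_val z)
  end.

End Homology.

Definition projective (R : nzRingType) (P : lmodType R) :=
  forall (M N : lmodType R) (g : {linear M -> N}) (f : {linear P -> N}),
    (forall y, exists x, g x = y) ->
    exists h : {linear P -> M}, forall x, g (h x) = f x.

Record proj_resolution (R : nzRingType) (M : lmodType R) := ProjResolution {
  res_cpx :> complex R;
  res_aug : {linear res_cpx 0 -> M};
  res_proj : forall n, projective (res_cpx n);
  res_surj : forall m, exists z, res_aug z = m;
  res_exact0 : forall z,
    res_aug z = 0 <-> exists w, cdiff res_cpx 0 w = z;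
  res_exactS : forall n z,
    cdiff res_cpx n z = 0 <-> exists w, cdiff res_cpx n.+1 w = z
}.

(* The resolution of M by the free modules on the underlying sets of the
   successive syzygies *)
Section StdResolution.
Variables (R : nzRingType) (M : lmodType R).

Definition cover (N : lmodType R) : {linear (free_mod R N) -> N} :=
  flift (idfun : N -> N).

Fixpoint syz (n : nat) : lmodType R :=
  match n with 0 => M | n.+1 => ker (cover (syz n)) end.

Definition std_ob (n : nat) : lmodType R := free_mod R (syz n).

Definition std_diff n : {linear std_ob n.+1 -> std_ob n} :=
  @ker_incl _ _ _ (cover (syz n)) \o cover (syz n.+1).

Lemma cover_surj (N : lmodType R) y : exists x, cover N x = y.
Proof. by exists (fgen R y); rewrite /cover /= flift_gen. Qed.

Fact std_exactS n z : std_diff n z = 0 <-> exists w, std_diff n.+1 w = z.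
Proof.
split=> [dz|[w <-]]; last first.
  by rewrite /std_diff /= ker_inclP linear0.
have zk : kerp (cover (syz n.+1)) z.
  by apply/eqP; apply: val_inj.
have [w wz] := cover_surj (Ker zk : syz n.+2).
by exists w; rewrite /std_diff /= wz.
Qed.

Fact std_exact0 z : cover M z = 0 <-> exists w, std_diff 0 w = z.
Proof.
split=> [dz|[w <-]]; last by rewrite /std_diff /= ker_inclP.
have zk : kerp (cover M) z by apply/eqP.
have [w wz] := cover_surj (Ker zk : syz 1).
by exists w; rewrite /std_diff /= wz.
Qed.

Fact std_diffK n z : std_diff n (std_diff n.+1 z) = 0.
Proof. by apply/std_exactS; exists z. Qed.

Definition std_cpx := Complex std_diffK.

Lemma free_projective (X : choiceType) : projective (free_mod R X).
Proof.
move=> P Q g f gsurj.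
have [s sP] := choice (fun x : X => gsurj (f (fgen R x))).
exists (flift s); apply: (@free_ext _ _ _ (g \o flift s) f) => x /=.
by rewrite flift_gen sP.
Qed.

Definition std_resolution : proj_resolution M :=
  @ProjResolution R M std_cpx (cover M) (fun n => @free_projective (syz n))
    (@cover_surj M) std_exact0 std_exactS.

End StdResolution.

Section Tor.
Variables (k : fieldType) (R : algType k).
Variables (N : lmodType R^c) (M : lmodType R).

Section TensorComplex.
Variable C : complex R.

Fact tens_cpx_diffK n z :
  tmap N (cdiff C n) (tmap N (cdiff C n.+1) z) = 0.
Proof.
move: z; apply: (@tensR_ext _ _ _ _ _ (tmap N _ \o tmap N _) \0) => x m /=.
rewrite !tmap_tens cdiffK /tensr /=.
have := @tens_linearr k (restr N) (restr (C n)) x (-1) 0 0.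
by rewrite scaler0 addr0 scaleN1r addNr => ->; rewrite linear0.
Qed.

Definition tens_cpx : complex k := @Complex k (fun n => tensR N (C n))
  (fun n => tmap N (cdiff C n)) tens_cpx_diffK.

End TensorComplex.

Definition Tor (p : nat) : lmodType k :=
  homology (tens_cpx (std_resolution M)) p.

End Tor.

Section DirectSum.
Variables (k : fieldType) (M : nat -> lmodType k).

Definition fin_supp (f : forall n, M n) :=
  exists b, forall n, (b <= n)%N -> f n = 0.

Record dsum := DSum { dsum_fun :> forall n, M n; _ : fin_supp dsum_fun }.

Lemma dsumP (f g : dsum) : (forall n, f n = g n) -> f = g.
Proof.
case: f g => [f pf] [g pg] /= fg.
have e : f = g by exact: functional_extensionality_dep.
by move: pg; rewrite -e => pg; rewrite (Prop_irrelevance pf pg).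
Qed.

HB.instance Definition _ := gen_eqMixin dsum.
HB.instance Definition _ := gen_choiceMixin dsum.

Fact dsum0_subproof : fin_supp (fun n => 0 : M n).
Proof. by exists 0%N. Qed.
Fact dsumN_subproof (f : dsum) : fin_supp (fun n => - f n).
Proof. by case: f => f [b fb]; exists b => n /fb /= ->; rewrite oppr0. Qed.
Fact dsumD_subproof (f g : dsum) : fin_supp (fun n => f n + g n).
Proof.
case: f g => f [b fb] [g [c gc]]; exists (maxn b c) => n /=.
by rewrite geq_max => /andP [/fb -> /gc ->]; rewrite addr0.
Qed.
Fact dsumZ_subproof (a : k) (f : dsum) : fin_supp (fun n => a *: f n).
Proof. by case: f => f [b fb]; exists b => n /fb /= ->; rewrite scaler0. Qed.

Definition dsum0 := DSum dsum0_subproof.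
Definition dsumN f := DSum (dsumN_subproof f).
Definition dsumD f g := DSum (dsumD_subproof f g).
Definition dsumZ a f := DSum (dsumZ_subproof a f).

Fact dsumDA : associative dsumD.
Proof. by move=> f g h; apply: dsumP => n; apply: addrA. Qed.
Fact dsumDC : commutative dsumD.
Proof. by move=> f g; apply: dsumP => n; apply: addrC. Qed.
Fact dsum0D : left_id dsum0 dsumD.
Proof. by move=> f; apply: dsumP => n; apply: add0r. Qed.
Fact dsumND : left_inverse dsum0 dsumN dsumD.
Proof. by move=> f; apply: dsumP => n; apply: addNr. Qed.
HB.instance Definition _ :=
  GRing.isZmodule.Build dsum dsumDA dsumDC dsum0D dsumND.

Fact dsumZA a b f : dsumZ a (dsumZ b f) = dsumZ (a * b) f.
Proof. by apply: dsumP => n; apply: scalerA. Qed.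
Fact dsumZ1 : left_id 1 dsumZ.
Proof. by move=> f; apply: dsumP => n; apply: scale1r. Qed.
Fact dsumZDr : right_distributive dsumZ +%R.
Proof. by move=> a f g; apply: dsumP => n; apply: scalerDr. Qed.
Fact dsumZDl f : {morph dsumZ^~ f : a b / a + b}.
Proof. by move=> a b; apply: dsumP => n; apply: scalerDl. Qed.
HB.instance Definition _ := GRing.Zmodule_isLmodule.Build k dsum
  dsumZA dsumZ1 dsumZDr dsumZDl.

End DirectSum.

Definition finite_dim (k : fieldType) (V : lmodType k) :=
  exists (d : nat) (b : 'I_d -> V), forall v, exists c : 'I_d -> k,
    v = \sum_i c i *: b i.

Section Enveloping.
Variables (k : fieldType) (A : algType k).

Definition env := tensk A A^c.
HB.instance Definition _ := GRing.Lmodule.on env.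

Definition ep (a b : A) : env := tens a (b : A^c).

Lemma ep_linearl b : linear (ep^~ b).
Proof. exact: tens_linearl. Qed.
Lemma ep_linearr a : linear (ep a).
Proof. exact: (@tens_linearr k A A^c a). Qed.

Lemma env_ext (U : lmodType k) (f g : {linear env -> U}) :
  (forall a b, f (ep a b) = g (ep a b)) -> f =1 g.
Proof. by move=> fg; apply: tens_ext => a b; apply: fg. Qed.

(* Left and right actions on A: (a (x) b) . x = a x b and
   x . (a (x) b) = b x a *)
Fact env_lact_bilinear x : @bilinear_map k A A^c A (fun a b => a * x * (b : A)).
Proof.
split=> [b c a a'|a c b b'].
  by rewrite !mulrDl -!scalerAl.
by rewrite mulrDr -scalerAr.
Qed.
Definition env_lact (x : A) : {linear env -> A} := tlift (env_lact_bilinear x).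

Fact env_ract_bilinear x : @bilinear_map k A A^c A (fun a b => (b : A) * x * a).
Proof.
split=> [b c a a'|a c b b'].
  by rewrite mulrDr -scalerAr.
by rewrite !mulrDl -!scalerAl.
Qed.
Definition env_ract (x : A) : {linear env -> A} := tlift (env_ract_bilinear x).

Lemma env_lact_ep x a b : env_lact x (ep a b) = a * x * b.
Proof. exact: tlift_tens. Qed.
Lemma env_ract_ep x a b : env_ract x (ep a b) = b * x * a.
Proof. exact: tlift_tens. Qed.

(* Multiplication: (a (x) b)(a' (x) b') = a a' (x) b' b *)
Fact env_mul1_bilinear (a : A) (b : A^c) : @bilinear_map k A A^c env
  (fun a' b' => tens (a * a') (b * b')).
Proof.
split=> [b' c x y|a' c x y].
  by rewrite mulrDr -scalerAr tens_linearl.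
by rewrite mulrDr -scalerAr tens_linearr.
Qed.
Definition env_mul1 (a : A) (b : A^c) : {linear env -> env} :=
  tlift (env_mul1_bilinear a b).

Lemma env_mul1_ep a b a' b' :
  env_mul1 a (b : A^c) (ep a' b') = ep (a * a') (b' * b).
Proof. exact: tlift_tens. Qed.

Fact env_mul_bilinear (t : env) : @bilinear_map k A A^c env
  (fun a b => env_mul1 a b t).
Proof.
split=> [b|a] c x y; elim/tens_ind: t => [s t IHs IHt|a' b'].
- by rewrite !linearD /= IHs IHt addrACA.
- by rewrite !env_mul1_ep mulrDl -scalerAl ep_linearl.
- by rewrite !linearD /= IHs IHt addrACA.
- by rewrite !env_mul1_ep mulrDr -scalerAr ep_linearr.
Qed.
Definition env_mul (s t : env) : env := tlift (env_mul_bilinear t) s.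

Lemma env_mul_ep a b a' b' :
  env_mul (ep a b) (ep a' b') = ep (a * a') (b' * b).
Proof. by rewrite /env_mul tlift_tens env_mul1_ep. Qed.

Lemma env_mul_linearl t : linear (env_mul^~ t).
Proof. exact: linearP. Qed.

Lemma env_mul_linearr s : linear (env_mul s).
Proof.
move=> c x y; elim/tens_ind: s => [s t IHs IHt|a b].
  by rewrite /env_mul !linearD /= -!/(env_mul _ _) IHs IHt addrACA.
by rewrite /env_mul !tlift_tens linearP.
Qed.

Fact env_mulDl : left_distributive env_mul +%R.
Proof. by move=> x y t; rewrite /env_mul linearD. Qed.
Fact env_mulDr : right_distributive env_mul +%R.
Proof.
by move=> s x y; have := env_mul_linearr s 1 x y; rewrite !scale1r.
Qed.
Fact env_mulA : associative env_mul.
Proof.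
move=> s t u; elim/tens_ind: s => [s s' IH IH'|a b].
  by rewrite !env_mulDl IH IH'.
elim/tens_ind: t => [t t' IH IH'|a' b'].
  by rewrite env_mulDl !env_mulDr env_mulDl IH IH'.
elim/tens_ind: u => [u u' IH IH'|a'' b'']; first by rewrite !env_mulDr IH IH'.
by rewrite !env_mul_ep !mulrA.
Qed.
Fact env_mul1l : left_id (ep 1 1) env_mul.
Proof.
move=> s; elim/tens_ind: s => [s t IH IH'|a b].
  by rewrite env_mulDr IH IH'.
by rewrite env_mul_ep mul1r mulr1.
Qed.
Fact env_mul1r : right_id (ep 1 1) env_mul.
Proof.
move=> s; elim/tens_ind: s => [s t IH IH'|a b].
  by rewrite env_mulDl IH IH'.
by rewrite env_mul_ep mul1r mulr1.
Qed.
Fact env_1neq0 : ep 1 1 != 0.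
Proof.
apply/eqP => /(congr1 (env_lact 1)); rewrite env_lact_ep linear0 !mulr1.
by apply/eqP/oner_neq0.
Qed.
HB.instance Definition _ := GRing.Zmodule_isNzRing.Build env
  env_mulA env_mul1l env_mul1r env_mulDl env_mulDr env_1neq0.

Fact env_scaleAl (c : k) (x y : env) : c *: (x * y) = (c *: x) * y.
Proof.
rewrite -[RHS]/(env_mul _ _) -[c *: x]addr0 (env_mul_linearl y c x 0).
by rewrite -[env_mul 0 y]/(0 * y) mul0r addr0.
Qed.
HB.instance Definition _ := GRing.Lmodule_isLalgebra.Build k env env_scaleAl.

Fact env_scaleAr (c : k) (x y : env) : c *: (x * y) = x * (c *: y).
Proof.
rewrite -[RHS]/(env_mul _ _) -[c *: y]addr0 (env_mul_linearr x c y 0).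
by rewrite -[env_mul x 0]/(x * 0) mulr0 addr0.
Qed.
HB.instance Definition _ := GRing.Lalgebra_isAlgebra.Build k env env_scaleAr.

Lemma ep_mul a b a' b' : ep a b * ep a' b' = ep (a * a') (b' * b).
Proof. exact: env_mul_ep. Qed.

Definition lself : Type := A.
HB.instance Definition _ := GRing.Zmodule.on lself.

Definition lself_scale (t : env) (x : lself) : lself := env_lact (x : A) t.

Lemma env_lactD t x y : env_lact (x + y) t = env_lact x t + env_lact y t.
Proof.
elim/tens_ind: t => [s t IH IH'|a b].
  by rewrite !linearD /= IH IH' addrACA.
by rewrite !env_lact_ep mulrDr mulrDl.
Qed.
Fact lself_scaleA s t x :
  lself_scale s (lself_scale t x) = lself_scale (s * t) x.
Proof.
rewrite /lself_scale; elim/tens_ind: s => [s s' IH IH'|a b].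
  by rewrite mulrDl !linearD /= IH IH'.
elim/tens_ind: t => [t t' IH IH'|a' b'].
  by rewrite mulrDr !linearD /= env_lactD IH IH'.
by rewrite ep_mul !env_lact_ep !mulrA.
Qed.
Fact lself_scale1 : left_id 1 lself_scale.
Proof. by move=> x; rewrite /lself_scale env_lact_ep mul1r mulr1. Qed.
Fact lself_scaleDr : right_distributive lself_scale +%R.
Proof. by move=> t x y; apply: env_lactD. Qed.
Fact lself_scaleDl x : {morph lself_scale^~ x : s t / s + t}.
Proof. by move=> s t; rewrite /lself_scale linearD. Qed.
HB.instance Definition _ := GRing.Zmodule_isLmodule.Build env lself
  lself_scaleA lself_scale1 lself_scaleDr lself_scaleDl.

Definition rself : Type := A.
HB.instance Definition _ := GRing.Zmodule.on rself.

Definition rself_scale (t : env^c) (x : rself) : rself :=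
  env_ract (x : A) (t : env).

Lemma env_ractD t x y : env_ract (x + y) t = env_ract x t + env_ract y t.
Proof.
elim/tens_ind: t => [s t IH IH'|a b].
  by rewrite !linearD /= IH IH' addrACA.
by rewrite !env_ract_ep mulrDr mulrDl.
Qed.
Lemma env_ractM (s t : env) x : env_ract (env_ract x s) t = env_ract x (s * t).
Proof.
elim/tens_ind: s => [s s' IH IH'|a b].
  by rewrite mulrDl !linearD /= env_ractD IH IH'.
elim/tens_ind: t => [t t' IH IH'|a' b'].
  by rewrite mulrDr !linearD /= IH IH'.
by rewrite ep_mul !env_ract_ep !mulrA.
Qed.
Fact rself_scaleA s t x :
  rself_scale s (rself_scale t x) = rself_scale (s * t) x.
Proof. exact: env_ractM. Qed.
Fact rself_scale1 : left_id 1 rself_scale.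
Proof. by move=> x; rewrite /rself_scale env_ract_ep mul1r mulr1. Qed.
Fact rself_scaleDr : right_distributive rself_scale +%R.
Proof. by move=> t x y; apply: env_ractD. Qed.
Fact rself_scaleDl x : {morph rself_scale^~ x : s t / s + t}.
Proof. by move=> s t; rewrite /rself_scale linearD. Qed.
HB.instance Definition _ := GRing.Zmodule_isLmodule.Build env^c rself
  rself_scaleA rself_scale1 rself_scaleDr rself_scaleDl.

Definition HH (p : nat) : lmodType k := Tor rself lself p.

End Enveloping.

Record connected_grading (k : fieldType) (A : falgType k) := ConnectedGrading {
  gr :> nat -> {vspace A};
  (* A is finite dimensional, so only finitely many components are nonzero *)
  gr_bound : nat;
  gr_vanish : forall n, (gr_bound <= n)%N -> gr n = 0%VS;
  gr_sum : (\sum_(n < gr_bound) gr n)%VS = fullv;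
  gr_direct : directv (\sum_(n < gr_bound) gr n)%VS;
  gr_mul : forall m n, (gr m * gr n <= gr (m + n)%N)%VS;
  gr_conn : gr 0 = 1%VS
}.

Section Generators.
Variables (k : fieldType) (A : falgType k) (G : connected_grading A).

Definition gr_pos : {vspace A} := (\sum_(1 <= n < gr_bound G) G n)%VS.

(* The images of x_1, ..., x_r form a basis of gr_pos / gr_pos ^ 2 *)
Definition generators (r : nat) (x : 'I_r -> A) :=
  [/\ forall i, x i \in gr_pos,
      forall c : 'I_r -> k,
        \sum_i c i *: x i \in (gr_pos * gr_pos)%VS -> forall i, c i = 0
    & forall a, a \in gr_pos -> exists c : 'I_r -> k,
        a - \sum_i c i *: x i \in (gr_pos * gr_pos)%VS].

End Generators.

(* Main.v *)
Require Import Defs.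
From mathcomp Require Import all_boot all_algebra all_field.
From HB Require Import structures.
From mathcomp Require Import boolp functions.
From mathcomp Require Import ring.

(** In every odd degree [p] a nonzero class of [HH_p(A)] is exhibited.  Write
    [x] and [y] for the two generators and [V] for a plane with basis [x, y].
    A linear functional that kills [k] and the square of the augmentation ideal
    is a derivation into [k]; two of them, dual to [x] and [y], define together
    with the augmentation a surjection from [A] onto the algebra
    [D = k + V] with [V V = 0] ([augmentation], [derivation],
    [square_zero_quotient]).

    In the bar complex, [x [y|x|...|y]] with [p] letters in the brackets is a
    cycle, since every product of neighbours is [x y] or [y x], hence [0].  It
    does not bound even in [HH_p(D)]: the functional

      (coefficient of the word xyxy...xy) - (coefficient of yxyx...yx)

    on words of even length [p + 1] kills all boundaries, since the inner
    products vanish in [D] and the two outer ones cancel after a cyclic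
    rotation, which exchanges the two words.  Its value on the cycle is [1], in
    any characteristic.

    Tor being computed here from the free resolution on the successive
    syzygies, this is transported as follows.  The Koszul resolution
    [D (x) V^(x)p (x) D] of [D] has an explicit contracting homotopy
    ([homotP], [homot0P]), which turns into an explicit chain map [cmp] from any
    complex of free bimodules augmented to [A] ([cmp_chain]); the functional is
    [psi] composed with [cmp], and kills boundaries by [psi_dif].  In the other
    direction, exactness of the resolution lifts the two alternating words of
    each length to elements [s b] whose differentials have the same shape as in
    the bar complex ([face], [alternating]).  The lifts involve choices, and so
    do their images in the Koszul resolution; but on the cycle [psi] only sees
    the coefficients of [1 [w] 1], which the differential determines
    ([word_coefs_step]). *)

Set Implicit Arguments.
Unset Strict Implicit.
Unset Printing Implicit Defensive.

Import GRing.Theory.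
Local Open Scope ring_scope.

(** * Balanced maps on a tensor product *)

Section BalancedMaps.
Variables (k : fieldType) (R : algType k).
Variables (N : lmodType R^c) (M : lmodType R).

Lemma tensr_balanced (n : N) (r : R) (m : M) :
  tensr ((r : R^c) *: n) m = tensr n (r *: m).
Proof. by apply/eqP; rewrite /tensr qpi_eq; apply/spanp_mem/Bal. Qed.

Lemma tensrDr (n : N) (m m' : M) :
  tensr n (m + m') = tensr n m + tensr n m'.
Proof.
have := tens_linearr (n : restr N) 1 (m : restr M) (m' : restr M).
by rewrite !scale1r /tensr => ->; rewrite linearD.
Qed.

Lemma tensr0l (m : M) : tensr (0 : N) m = 0.
Proof.
have := tens_linearl (m : restr M) (-1) (0 : restr N) 0.
by rewrite scaler0 addr0 scaleN1r addNr /tensr => ->; rewrite linear0.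
Qed.

Lemma tensr_annihilated (n : N) (r : R) (m : M) :
  (r : R^c) *: n = 0 -> tensr n (r *: m) = 0.
Proof. by move=> rn; rewrite -tensr_balanced rn tensr0l. Qed.

(** The universal property of [tensR].  Balancedness transfers homogeneity over
    [k] from the left argument to the right one. *)
Lemma balanced_lift (V : lmodType k) (b : N -> M -> V) :
  (forall m, {morph b^~ m : n n' / n + n'}) ->
  (forall c n m, b ((c%:A : R^c) *: n) m = c *: b n m) ->
  (forall n, {morph b n : m m' / m + m'}) ->
  (forall (r : R) n m, b ((r : R^c) *: n) m = b n (r *: m)) ->
  exists F : {linear tensR N M -> V}, forall n m, F (tensr n m) = b n m.
Proof.
move=> bDl bZ bDr bal.
have bb : @bilinear_map k (restr N) (restr M) V b.
  split=> [m|n] c y z.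
    by rewrite bDl [c *: y]/((c%:A : R^c) *: (y : N)) bZ.
  by rewrite bDr [c *: y]/((c%:A : R) *: (y : M)) -bal bZ.
have bal0 u : @bal_rel k R N M u -> tlift bb u = 0.
  by case=> n r m; rewrite linearB /= !tlift_tens bal subrr.
exists (qlift bal0) => n m.
exact: etrans (qlift_pi bal0 _) (tlift_tens bb _ _).
Qed.

Lemma tmap_ext0 (V : lmodType k) (M' : lmodType R) (f : {linear M' -> M})
    (F : {linear tensR N M -> V}) :
  (forall n m, F (tensr n (f m)) = 0) -> forall t, F (tmap N f t) = 0.
Proof.
move=> F0; apply: (@tensR_ext _ _ _ _ _ (F \o tmap N f) \0) => n m /=.
by rewrite tmap_tens F0.
Qed.

End BalancedMaps.

(** * The square-zero quotient and its bimodule of coefficients *)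

(** A homomorphism from [A] to [D = k + V], where [V] is a plane and [V V = 0],
    given by its coordinates: [eps] along [k] and [der c] along the letter [c].
    The two basis vectors of [V] are indexed by [bool], so that [~~ c] is the
    other letter. *)
Record square_zero_quotient (k : fieldType) (A : algType k) := SquareZeroQuotient {
  eps : {scalar A};
  der : bool -> {scalar A};
  eps1 : eps 1 = 1;
  epsM : forall a b, eps (a * b) = eps a * eps b;
  derM : forall c a b, der c (a * b) = eps a * der c b + der c a * eps b
}.

Section Coefficients.
Variables (k : fieldType) (A : algType k) (Q : square_zero_quotient A).

Lemma der1 c : der Q c 1 = 0.
Proof.
have := derM Q c 1 1; rewrite mulr1 eps1 mul1r mulr1 => /eqP.
by rewrite -subr_eq subrr eq_sym => /eqP.
Qed.

(** Elements of [D (x) D], by their coordinates; [None] stands for the basis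
    vector [1] of [D], and [Some c] for the letter [c]. *)
Definition coeffs : Type := option bool -> option bool -> k^o.
HB.instance Definition _ := GRing.Lmodule.on coeffs.

Lemma coeffsP (m n : coeffs) : (forall i j, m i j = n i j) -> m = n.
Proof. by move=> mn; apply/funext => i; apply/funext. Qed.

Lemma coeffsDE (m n : coeffs) i j : (m + n) i j = m i j + n i j.
Proof. by []. Qed.

Lemma coeffsZE (c : k) (m : coeffs) i j : (c *: m) i j = c * m i j.
Proof. by []. Qed.

Definition lmul (a : A) (m : coeffs) : coeffs := fun i j =>
  eps Q a * m i j + (if i is Some c then der Q c a * m None j else 0).
Definition rmul (m : coeffs) (b : A) : coeffs := fun i j =>
  eps Q b * m i j + (if j is Some c then der Q c b * m i None else 0).

Fact env_act_bilinear m :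
  @bilinear_map k A A^c coeffs (fun a b => rmul (lmul a m) b).
Proof.
split=> [b|a] c x y; apply: coeffsP => -[i|] [j|];
  rewrite !(coeffsDE, coeffsZE) /rmul /lmul;
  rewrite ?(linearP (eps Q)) ?(linearP (der Q _)) /=; ring.
Qed.
Definition env_act m : {linear env A -> coeffs} :=
  @tlift k A A^c coeffs _ (env_act_bilinear m).

Lemma env_act_ep m a b : env_act m (ep a b) = rmul (lmul a m) b.
Proof. exact: tlift_tens. Qed.

Lemma env_actD t m n : env_act (m + n) t = env_act m t + env_act n t.
Proof.
elim/tens_ind: t => [s t IH IH'|a b].
  by rewrite !linearD /= IH IH' addrACA.
rewrite !env_act_ep; apply: coeffsP => -[i|] [j|];
  rewrite /rmul /lmul !coeffsDE /=; ring.
Qed.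

(** The same space as a module over the enveloping algebra of [A]; the action
    depends on the quotient map, which is therefore a phantom argument. *)
Definition bim of square_zero_quotient A : Type := coeffs.
Local Notation B := (bim Q).
HB.instance Definition _ := GRing.Zmodule.on B.

Definition bim_scale (t : env A) (m : B) : B := env_act m t.

Fact bim_scaleA s t m : bim_scale s (bim_scale t m) = bim_scale (s * t) m.
Proof.
rewrite /bim_scale; elim/tens_ind: s => [s s' IH IH'|a b].
  by rewrite mulrDl !linearD /= IH IH'.
elim/tens_ind: t => [t t' IH IH'|a' b'].
  by rewrite mulrDr !linearD /= env_actD IH IH'.
rewrite ep_mul !env_act_ep; apply: coeffsP => -[i|] [j|];
  rewrite /rmul /lmul /= ?epsM ?derM; ring.
Qed.
Fact bim_scale1 : left_id 1 bim_scale.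
Proof.
move=> m; rewrite /bim_scale -[1]/(ep 1 1) env_act_ep.
by apply: coeffsP => -[i|] [j|]; rewrite /rmul /lmul /= ?eps1 ?der1; ring.
Qed.
Fact bim_scaleDr : right_distributive bim_scale +%R.
Proof. by move=> t m n; apply: env_actD. Qed.
Fact bim_scaleDl m : {morph bim_scale^~ m : s t / s + t}.
Proof. by move=> s t; rewrite /bim_scale linearD. Qed.
HB.instance Definition _ := GRing.Zmodule_isLmodule.Build (env A) B
  bim_scaleA bim_scale1 bim_scaleDr bim_scaleDl.

Lemma bimDE (m n : B) i j : (m + n) i j = m i j + n i j.
Proof. by []. Qed.

Lemma ep_bimE a b (m : B) : ep a b *: m = rmul (lmul a m) b.
Proof. exact: env_act_ep. Qed.

(** * The Koszul resolution of the square-zero algebra *)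

(** The value at [w] is the coefficient in [D (x) D] of the word [w]; the
    component of degree [p] is [D (x) V^(x)p (x) D].  Functions on words of all
    lengths are allowed, so that one module serves for all degrees; the
    statements about degree [p] then look only at words of length [p]. *)
Definition koszul : Type := seq bool -> B.
HB.instance Definition _ := GRing.Lmodule.on koszul.

Lemma koszulDE (y z : koszul) w : (y + z) w = y w + z w. Proof. by []. Qed.
Lemma koszulZE (t : env A) (z : koszul) w : (t *: z) w = t *: z w.
Proof. by []. Qed.

(** On chains, [a [w_1...w_p] b] is sent to
    [a w_1 [w_2...w_p] b + (-1)^p a [w_1...w_(p-1)] w_p b].  As [V V = 0], only
    [a = 1] contributes to the first term and [b = 1] to the second. *)
Definition dif (p : nat) (z : koszul) : koszul := fun w i j =>
  (if i is Some c then z (c :: w) None j else 0)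
  + (-1) ^+ p * (if j is Some c then z (rcons w c) i None else 0).

Lemma dif_cons p z w c : dif p z w (Some c) None = z (c :: w) None None.
Proof. by rewrite /dif mulr0 addr0. Qed.

Fact difD p : {morph dif p : y z / y + z}.
Proof.
move=> y z; apply/funext => w; apply: coeffsP => -[i|] [j|];
  rewrite koszulDE bimDE /dif ?koszulDE ?bimDE; ring.
Qed.

Fact difZ p : scalable (dif p).
Proof.
move=> t z; elim/tens_ind: t => [s t IHs IHt|a b].
  by rewrite !scalerDl difD IHs IHt.
apply/funext => w; apply: coeffsP => -[i|] [j|];
  rewrite koszulZE /dif ?koszulZE ?ep_bimE /rmul /lmul /=; ring.
Qed.

(** The map [c [w] b |-> 1 [c w] b], zero on [1 [w] b]. *)
Definition homot (z : koszul) : koszul := fun w i j =>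
  if (i, w) is (None, c :: v) then z v (Some c) j else 0.

(** The identity [d s + s d = 1] of a contracting homotopy, at a chain whose
    differential vanishes. *)
Lemma homotP p (z : koszul) w : size w = p.+1 ->
  (forall v, size v = p -> dif p.+1 z v = 0) -> dif p.+2 (homot z) w = z w.
Proof.
case: w => // h w [sw] dz; apply: coeffsP => -[i|] j.
  by rewrite /dif /homot /=; case: j => [j|]; ring.
have := congr1 (fun m : B => m (Some h) j) (dz w sw).
rewrite /dif /homot /=; case: j => [j|] e.
  by rewrite -[RHS]subr0 -[0 in RHS]e exprS; ring.
rewrite -[RHS]subr0 -[0 in RHS]e; ring.
Qed.

(** In degree [0] the hypotheses say that the multiplication [D (x) D -> D]
    sends [z [::]] to [0]: the products of two letters vanish in [D]. *)
Lemma homot0P (z : koszul) : z [::] None None = 0 ->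
  (forall c, z [::] (Some c) None + z [::] None (Some c) = 0) ->
  dif 1 (homot z) [::] = z [::].
Proof.
move=> z1 zc; apply: coeffsP => -[i|] [j|]; rewrite /dif /homot /= ?z1.
- ring.
- ring.
- by rewrite -[RHS]subr0 -[0 in RHS](zc j); ring.
ring.
Qed.

(** * Comparison with a complex of free modules *)

Lemma free_ind (R : nzRingType) (X : choiceType) (P : free_mod R X -> Prop) :
  P 0 -> (forall u v, P u -> P v -> P (u + v)) ->
  (forall t x, P (t *: fgen R x)) -> forall u, P u.
Proof.
by move=> P0 PD Pg u; rewrite (free_sum u); apply: (big_ind P) => // x _.
Qed.

Lemma dif0 p : dif p 0 = 0.
Proof. by rewrite -[0 in LHS](scale0r 0) difZ scale0r. Qed.

Lemma dif_ext (X : choiceType) (V : lmodType (env A)) p w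
    (g : {linear free_mod (env A) X -> koszul})
    (d : {linear free_mod (env A) X -> V}) (h : {linear V -> koszul}) :
  (forall x, dif p (g (fgen _ x)) w = h (d (fgen _ x)) w) ->
  forall u, dif p (g u) w = h (d u) w.
Proof.
move=> gh; elim/free_ind => [|u v IHu IHv|t x].
- by rewrite !linear0 dif0.
- by rewrite !linearD difD !koszulDE IHu IHv.
by rewrite !linearZ_LR difZ !koszulZE gh.
Qed.

Section Base.
Variables (X : choiceType) (aug : {linear free_mod (env A) X -> lself A}).

(** The element [a (x) 1] of [D (x) D], a preimage of [a] under the
    augmentation of the Koszul resolution. *)
Definition resolve (a : lself A) : koszul := fun w i j =>
  if (w, j) is ([::], None) then (if i is Some c then der Q c a else eps Q a)
  else 0.

Definition cmp_base : {linear free_mod (env A) X -> koszul} :=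
  flift (fun x => resolve (aug (fgen _ x))).

Lemma cmp_base_gen x : cmp_base (fgen _ x) = resolve (aug (fgen _ x)).
Proof. exact: flift_gen. Qed.

(** This and [cmp_base_der] say that [cmp_base] lifts the quotient map of [A]
    onto [D]: multiplying out [D (x) D -> D] gives the coordinates of
    [aug u]. *)
Lemma cmp_base_eps u : cmp_base u [::] None None = eps Q (aug u).
Proof.
elim/free_ind: u => [|u v IHu IHv|t x].
- by rewrite !linear0.
- by rewrite linearD koszulDE bimDE IHu IHv linearD [RHS]linearD.
rewrite !linearZ_LR cmp_base_gen koszulZE; move: (aug _) => a.
rewrite -[t *: a]/(env_lact (a : A) t).
elim/tens_ind: t => [s t IHs IHt|b b'].
  by rewrite scalerDl bimDE IHs IHt !linearD.
by rewrite ep_bimE env_lact_ep /rmul /lmul /= !epsM; ring.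
Qed.

Lemma cmp_base_der c u :
  cmp_base u [::] (Some c) None + cmp_base u [::] None (Some c)
  = der Q c (aug u).
Proof.
elim/free_ind: u => [|u v IHu IHv|t x].
- by rewrite !linear0 addr0.
- by rewrite linearD koszulDE !bimDE linearD [RHS]linearD -IHu -IHv /= addrACA.
rewrite !linearZ_LR cmp_base_gen koszulZE; move: (aug _) => a.
rewrite -[t *: a]/(env_lact (a : A) t).
elim/tens_ind: t => [s t IHs IHt|b b'].
  by rewrite scalerDl !bimDE !linearD -IHs -IHt /= addrACA.
by rewrite !ep_bimE env_lact_ep /rmul /lmul /resolve /= !derM epsM; ring.
Qed.

End Base.

(** One step of the comparison: on a generator, the next map is the contracting
    homotopy applied to the image of its boundary. *)
Section Step.
Variables (p : nat) (V : lmodType (env A)) (X : choiceType).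
Variables (d : {linear free_mod (env A) X -> V}) (g : {linear V -> koszul}).
Hypothesis g_homot : forall e w, size w = p ->
  dif p.+1 (homot (g (d (fgen _ e)))) w = g (d (fgen _ e)) w.

Definition cmp_step : {linear free_mod (env A) X -> koszul} :=
  flift (fun e => homot (g (d (fgen _ e)))).

Lemma cmp_step_gen e : cmp_step (fgen _ e) = homot (g (d (fgen _ e))).
Proof. exact: flift_gen. Qed.

Lemma cmp_step_chain u w : size w = p -> dif p.+1 (cmp_step u) w = g (d u) w.
Proof.
move=> sw; apply: dif_ext => e.
by rewrite cmp_step_gen g_homot.
Qed.

Lemma cmp_step_homot u w : d u = 0 -> size w = p.+1 ->
  dif p.+2 (homot (cmp_step u)) w = cmp_step u w.
Proof.
move=> du sw; apply: homotP => // v sv.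
by rewrite cmp_step_chain // du linear0.
Qed.

End Step.

Section Comparison.
Variables (X : nat -> choiceType).
Local Notation F p := (free_mod (env A) (X p)).
Variables (d : forall p, {linear F p.+1 -> F p}) (aug : {linear F 0 -> lself A}).
Hypothesis dK : forall p u, d p (d p.+1 u) = 0.
Hypothesis aug_d : forall u, aug (d 0 u) = 0.

Fixpoint cmp p : {linear F p -> koszul} :=
  if p is q.+1 then cmp_step (d q) (cmp q) else cmp_base aug.

Lemma cmp_homot p u w : size w = p ->
  dif p.+1 (homot (cmp p (d p u))) w = cmp p (d p u) w.
Proof.
elim: p => [|p IHp] in u w * => sw.
  rewrite (size0nil sw); apply: homot0P => [|c].
    by rewrite cmp_base_eps aug_d linear0.
  by rewrite cmp_base_der aug_d linear0.
by apply: cmp_step_homot => [e v||//]; [apply: IHp|apply: dK].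
Qed.

Lemma cmp_eps u : cmp 0 u [::] None None = eps Q (aug u).
Proof. exact: cmp_base_eps. Qed.

Lemma cmp_chain p u w : size w = p ->
  dif p.+1 (cmp p.+1 u) w = cmp p (d p u) w.
Proof. by apply: cmp_step_chain => e v; apply: cmp_homot. Qed.

(** * Lifting the alternating words *)

(* From here on [cmp] is known only through [cmp_eps] and [cmp_chain]. *)
#[local] Opaque cmp.

Hypothesis aug_surj : forall a, exists u, aug u = a.
Hypothesis exact0 : forall u, aug u = 0 -> exists v, d 0 v = u.
Hypothesis exactS : forall p u, d p u = 0 -> exists v, d p.+1 v = u.

Variable x : bool -> A.
Hypothesis xx : forall b, x b * x (~~ b) = 0.
Hypothesis epsx : forall b, eps Q (x b) = 0.
Hypothesis derx : forall c b, der Q c (x b) = (c == b)%:R.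

(** If [s b] lifts the alternating word of length [p] starting with [b], this is
    the boundary that the word of length [p + 1] starting with [b] has in the bar
    complex: its first letter is [b], and its last one is [b (+) odd p]. *)
Definition face p (s : bool -> F p) b : F p :=
  ep (x b) 1 *: s (~~ b) + (-1) ^+ p.+1 *: (ep 1 (x (b (+) odd p)) *: s b).

Lemma ep0l b : ep 0 b = 0 :> env A.
Proof. by have := ep_linearl b (-1) 0 0; rewrite scaler0 addr0 scaleN1r addNr. Qed.
Lemma ep0r a : ep a 0 = 0 :> env A.
Proof. by have := ep_linearr a (-1) 0 0; rewrite scaler0 addr0 scaleN1r addNr. Qed.

(** The two middle terms cancel, and the outer ones contain a product of two
    different letters, which is [0]. *)
Lemma face_face p (s : bool -> F p) (s' : bool -> F p.+1) :
  (forall b, d p (s' b) = face s b) -> forall b, d p (face s' b) = 0.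
Proof.
move=> ds b; rewrite /face linearD !linearZ_LR !ds /face.
rewrite !scalerDr -[(-1) ^+ p.+1]signr_odd -[(-1) ^+ p.+2]signr_odd /=.
have x10 := xx true; have x01 := xx false.
case: (odd p); case: b; rewrite /= ?expr0 ?expr1 ?scale1r ?scaleN1r ?scalerN
  !scalerA !ep_mul ?mul1r ?mulr1 ?x10 ?x01 ?ep0l ?ep0r !scale0r;
  by rewrite ?oppr0 ?add0r ?addr0 ?addNr ?subrr.
Qed.

Fixpoint alt (b : bool) n : seq bool :=
  if n is m.+1 then b :: alt (~~ b) m else [::].

Lemma size_alt b n : size (alt b n) = n.
Proof. by elim: n b => //= n IH b; rewrite IH. Qed.

Lemma alt_rcons b n : alt b n.+1 = rcons (alt b n) (b (+) odd n).
Proof.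
elim: n b => [|n IH] b; first by rewrite /= addbF.
rewrite -[alt b n.+2]/(b :: alt (~~ b) n.+1) IH /=.
by rewrite addNb addbN.
Qed.

(** The letters have no component along [1], so only the first term of [face]
    contributes to a coefficient with [1] on the right. *)
Lemma face_coef p (s : bool -> F p) b w i :
  cmp p (face s b) w i None
  = if i is Some c then (c == b)%:R * cmp p (s (~~ b)) w None None else 0.
Proof.
rewrite /face linearD !linearZ_LR koszulDE !koszulZE bimDE -signr_odd.
case: (odd _); rewrite /= ?expr1 ?expr0 ?scaleN1r ?scale1r !ep_bimE.
  rewrite -[(- _) i None]/(- (rmul _ _ i None)).
  by case: i => [c|]; rewrite /rmul /lmul /= ?epsx ?eps1 ?derx ?der1; ring.
by case: i => [c|]; rewrite /rmul /lmul /= ?epsx ?eps1 ?derx ?der1; ring.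
Qed.

Lemma cmp_cons p u c w : size w = p ->
  cmp p.+1 u (c :: w) None None = cmp p (d p u) w (Some c) None.
Proof.
move=> sw; have := congr1 (fun m : B => m (Some c) None) (cmp_chain u sw).
by rewrite dif_cons => e; apply: e.
Qed.

(** Whatever the choice of the lifts, the comparison map sends [s b] to the
    alternating word, up to terms with a letter outside the brackets. *)
Definition word_coefs p (s : bool -> F p) := forall b w, size w = p ->
  cmp p (s b) w None None = (w == alt b p)%:R.

(** The coefficient of [1 [c w] 1] in a chain is the coefficient of [c [w] 1]
    in its differential, which [face] gives. *)
Lemma word_coefs_step p (s : bool -> F p) (s' : bool -> F p.+1) :
  (forall b, d p (s' b) = face s b) -> word_coefs s -> word_coefs s'.
Proof.
move=> ds cs b [|c w] // [sw].
rewrite cmp_cons // ds (face_coef s b w (Some c)) (cs _ _ sw) eqseq_cons.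
by case: eqP; rewrite ?mul1r ?mul0r.
Qed.

Lemma alternating p : exists2 s : bool -> F p, word_coefs s &
  exists s' : bool -> F p.+1, forall b, d p (s' b) = face s b.
Proof.
elim: p => [|p [s cs [s' ds]]].
  have [u au] := aug_surj (1 : A).
  exists (fun=> u) => [b w /size0nil->|]; first by rewrite cmp_eps au eps1.
  have bd b : exists v, d 0 v = face (fun=> u) b.
    apply: exact0; rewrite /face linearD !linearZ_LR au /= expr1 scaleN1r addbF.
    rewrite -[ep (x b) 1 *: _]/(env_lact (1 : A) _).
    rewrite -[ep 1 (x b) *: _]/(env_lact (1 : A) _).
    by rewrite !env_lact_ep !mulr1 !mul1r subrr.
  by have [s' ds] := choice bd; exists s'.
exists s'; first exact: word_coefs_step ds cs.
have bd b : exists v, d p.+1 v = face s' b.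
  by apply: exactS; apply: face_face ds b.
by have [s'' ds'] := choice bd; exists s''.
Qed.

(** * A functional on Hochschild homology *)

Let E : algType k := env A.
Let RA : lmodType E^c := rself A.

Section Functional.
Variable p : nat.
Hypothesis odd_p : odd p.

(** The class of [a] tensor [u [w] v] is that of [v a u [w]], with [v a u] in [D];
    this is the coefficient in it of the alternating word of length [p + 1] that
    starts with [c]. *)
Definition psi_term (a : A) (z : koszul) c : k^o :=
  der Q c a * z (alt (~~ c) p) None None
  + eps Q a * (z (alt (~~ c) p) (Some c) None
               + z (alt (~~ c) p) None (Some c)).

(** The difference of the coefficients of the two alternating words of the even
    length [p + 1]. *)
Definition psi (a : A) (z : koszul) : k^o :=
  psi_term a z true - psi_term a z false.

Fact psiD a y z : psi a (y + z) = psi a y + psi a z.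
Proof. rewrite /psi /psi_term !koszulDE !bimDE; ring. Qed.

Fact psiDl a b z : psi (a + b) z = psi a z + psi b z.
Proof. rewrite /psi /psi_term !linearD /=; ring. Qed.

Fact psiZl c a z : psi (c *: a) z = c * psi a z.
Proof. rewrite /psi /psi_term !linearZ /=; ring. Qed.

Lemma psi_env (t : env A) a z : psi a (t *: z) = psi (env_ract a t) z.
Proof.
elim/tens_ind: t => [s t IHs IHt|b b'].
  by rewrite scalerDl psiD IHs IHt linearD psiDl.
rewrite env_ract_ep /psi /psi_term !koszulZE !ep_bimE /rmul /lmul.
rewrite !derM !epsM /=; ring.
Qed.

(** The boundary of [1 [w] 1] contributes the word [w] and its cyclic rotation,
    both with sign [+] since [p + 1] is even.  The rotation exchanges the two
    alternating words of length [p + 1], which have opposite signs in [psi]. *)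
Lemma psi_dif a z y : (forall w, size w = p -> dif p.+1 z w = y w) ->
  psi a y = 0.
Proof.
move=> zy; have sgn : (-1) ^+ p.+1 = 1 :> k by rewrite -signr_odd /= odd_p.
have altE c : rcons (alt (~~ c) p) c = alt (~~ c) p.+1.
  by rewrite alt_rcons odd_p addbT negbK.
rewrite /psi /psi_term -!zy ?size_alt // /dif sgn !altE /=; ring.
Qed.

Lemma hh_functional : exists Phi : {linear @tensR k E RA (F p) -> k^o},
  (forall a u, Phi (@tensr k E RA _ a u) = psi a (cmp p u)) /\
  (forall t, Phi (@tmap k E RA _ _ (d p) t) = 0).
Proof.
have [||||Phi PhiE] := @balanced_lift k E RA (F p) k^o
  (fun a u => psi a (cmp p u)).
- by move=> u a b; apply: psiDl.
- move=> c a u; rewrite -[_ *: a]/(env_ract (a : A) (c *: ep 1 1)).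
  by rewrite linearZ_LR env_ract_ep mul1r mulr1 psiZl.
- by move=> a u v; rewrite linearD psiD.
- by move=> t a u; rewrite linearZ_LR psi_env.
exists Phi; split=> //; apply: tmap_ext0 => a u; rewrite PhiE.
exact: psi_dif _ (fun w sw => cmp_chain u sw).
Qed.

End Functional.

(** The cycle is [x true] tensor the lift of the alternating word of length
    [p + 1] starting and ending with [false]: a boundary term contains the product
    of [x true] with [x false], in one order or the other. *)
Lemma nonbounding_cycle p : ~~ odd p ->
  exists (t : @tensR k E RA (F p.+1))
    (Phi : {linear @tensR k E RA (F p.+1) -> k^o}),
  [/\ @tmap k E RA _ _ (d p) t = 0,
      forall v, Phi (@tmap k E RA _ _ (d p.+1) v) = 0 & Phi t = 1].
Proof.
move=> ev; have [s cs [s' ds]] := alternating p.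
have cs' := word_coefs_step ds cs.
have [Phi [PhiE Phi0]] := @hh_functional p.+1 ev.
exists (@tensr k E RA _ (x true) (s' false)), Phi; split=> //; last first.
  by rewrite PhiE /psi /psi_term !cs' ?size_alt // !derx epsx !eqxx /=; ring.
rewrite tmap_tens ds /face scalerA -commr_sign -scalerA tensrDr.
rewrite !tensr_annihilated ?addr0 //.
  rewrite -[LHS]/(env_ract (x true) (ep 1 (x (false (+) odd p)))) env_ract_ep.
  by rewrite (negbTE ev) mulr1 (xx false).
rewrite -[LHS]/(env_ract (x true) (ep (x false) 1)) env_ract_ep.
by rewrite mul1r (xx true).
Qed.

End Comparison.

End Coefficients.

(** * From nonzero classes to infinite dimension *)

Lemma homology_neq0 (k : fieldType) (C : complex k) p (t : C p.+1)
    (Phi : {linear C p.+1 -> k^o}) :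
  cdiff C p t = 0 -> (forall v, Phi (cdiff C p.+1 v) = 0) -> Phi t = 1 ->
  exists z : homology C p.+1, z <> 0.
Proof.
move=> dt Phi0 Phi1; have kt : kerp (cdiff C p) t by apply/eqP.
exists (qpi _ (Ker kt)) => /eqP; rewrite qpi_eq0 => /spanpP [s [sB /= st]].
have : Phi (ker_incl (Ker kt)) = 0; last first.
  by rewrite /ker_incl /= Phi1 => /eqP; rewrite oner_eq0.
rewrite st !linear_sum big_seq big1 // => q /sB [w wE].
rewrite !linearZ_LR; suff -> : Phi (ker_incl q.2) = 0 by rewrite scaler0.
by rewrite -[ker_incl _]/(ker_val q.2) -wE Phi0.
Qed.

(** Finitely many elements of a direct sum vanish in all high degrees. *)
Lemma dsum_infinite (k : fieldType) (M : nat -> lmodType k) :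
  (forall b, exists2 n, (b <= n)%N & exists z : M n, z <> 0) ->
  ~ finite_dim (dsum M).
Proof.
move=> nzM [r [v vP]].
have [b vb] : exists b, forall i n, (b <= n)%N -> v i n = 0.
  have fv i : fin_supp (v i) by case: (v i).
  have [b vb] := choice fv; exists (\max_i b i)%N => i n bn.
  by apply: vb; apply: leq_trans bn; apply: (leq_bigmax i).
have [n bn [z nz]] := nzM b; apply: nz.
pose f m : M m := if @eqP _ n m is ReflectT e then ecast m (M m) e z else 0.
have ff : fin_supp f.
  exists n.+1 => m nm; rewrite /f; case: eqP => // e.
  by move: nm; case: _ / e; rewrite ltnn.
have fn : f n = z.
  by rewrite /f; case: eqP => // e; rewrite (eq_axiomK e).
have [c fc] := vP (DSum ff).
have : DSum ff n = z by [].
suff -> : DSum ff n = 0 by [].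
rewrite fc; elim/big_rec: _ => // i g _ gn.
by rewrite -[LHS]/(c i *: v i n + g n) gn vb // scaler0 addr0.
Qed.

(** The first coordinate in the free family made of [v] and a basis of [U]. *)
Lemma vspace_functional (k : fieldType) (V : vectType k) (U : {vspace V}) (v : V) :
  v \notin U -> exists2 f : {scalar V}, f v = 1 & forall u, u \in U -> f u = 0.
Proof.
move=> vU; pose X := [tuple of v :: vbasis U].
have fX : free X.
  by rewrite free_cons (span_basis (vbasisP U)) vU (basis_free (vbasisP U)).
exists (coord X ord0) => [|u uU].
  by rewrite [LHS](coord_free ord0 ord0 fX).
rewrite (coord_vbasis uU) linear_sum big1 // => i _.
have e : coord X ord0 (vbasis U)`_i = 0.
  exact: (coord_free (lift ord0 i) ord0 fX).
by rewrite linearZ /= e mulr0.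
Qed.

(** * The augmentation and the derivations of a connected graded algebra *)

Section Grading.
Variables (k : fieldType) (A : falgType k) (G : connected_grading A).

Lemma gr_bound_gt0 : (0 < gr_bound G)%N.
Proof.
case: (posnP (gr_bound G)) => // B0; have := memvf (1 : A).
by rewrite -(gr_sum G) B0 big_ord0 memv0 oner_eq0.
Qed.

Lemma gr_posE : gr_pos G = (\sum_(n < (gr_bound G).-1) G n.+1)%VS.
Proof. by rewrite /gr_pos big_add1 big_mkord. Qed.

Lemma gr_decomp (a : A) :
  exists l : k, exists2 c, c \in gr_pos G & a = l%:A + c.
Proof.
have := memvf a; rewrite -(gr_sum G) gr_posE.
case: (gr_bound G) gr_bound_gt0 => // b _.
rewrite big_ord_recl gr_conn => /memv_addP [u /vlineP [l ->] [c cG ->]].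
by exists l; exists c.
Qed.

Lemma gr_sub_pos n : (0 < n)%N -> (G n <= gr_pos G)%VS.
Proof.
case: n => // n _; rewrite gr_posE.
have [nb|] := ltnP n (gr_bound G).-1; first exact: (sumv_sup (Ordinal nb)).
by move=> bn; rewrite gr_vanish ?sub0v // -(prednK gr_bound_gt0) ltnS.
Qed.

Lemma gr_pos_mul : (gr_pos G * gr_pos G <= gr_pos G)%VS.
Proof.
rewrite [X in (X * X)%VS]gr_posE big_distrlr /=.
apply/subv_sumP => m _; apply/subv_sumP => n _.
exact: subv_trans (gr_mul _ _ _) (gr_sub_pos _).
Qed.

(** A decomposition of [1] into components of positive degree would be a linear
    relation between the components, contrary to the directness of the sum. *)
Lemma one_notin_gr_pos : 1 \notin gr_pos G.
Proof.
rewrite gr_posE; move: (gr_direct G).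
case: (gr_bound G) gr_bound_gt0 => // b _ /directv_sum_independent dir.
apply/memv_sumP => -[/= u uG u1].
pose v i := if unlift ord0 i is Some j then - u j else 1 : A.
have vG i : true -> v i \in G i.
  rewrite /v; case: unliftP => [j ->|->] _; first by rewrite memvN uG.
  by rewrite gr_conn memv_line.
have v0 : \sum_i v i = 0.
  rewrite big_ord_recl /v unlift_none {1}u1 -big_split big1 //= => j _.
  by rewrite liftK subrr.
by have /eqP := dir v vG v0 ord0 isT; rewrite /v unlift_none oner_eq0.
Qed.

End Grading.

Section Coordinates.
Variables (k : fieldType) (A : falgType k) (G : connected_grading A).
Variables (r : nat) (x : 'I_r -> A) (genx : generators G x).
Variables (i j : 'I_r) (neq_ij : i != j).

Lemma augmentation : exists e : {scalar A},
  [/\ e 1 = 1, forall a, a \in gr_pos G -> e a = 0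
    & forall a b, e (a * b) = e a * e b].
Proof.
have [e e1 eG] := vspace_functional (one_notin_gr_pos G).
exists e; split=> // a b.
have [l [a' aG ->]] := gr_decomp G a; have [m [b' bG ->]] := gr_decomp G b.
rewrite !mulrDl !mulrDr !linearD /= -!scalerAl !mul1r !linearZ /= e1.
rewrite (eG a') // (eG b') // (eG (a' * b')) ?mulr1 ?linearZ /=.
  rewrite -scalerAr mulr1 linearZ /= eG // !mulr0 !addr0; ring.
by apply: (subvP (gr_pos_mul G)); apply: memv_mul.
Qed.

(** The functional is chosen to vanish on [1], on [x j] and on all products of
    two elements of positive degree; the Leibniz rule is then read off the
    decomposition [A = k + gr_pos G].  That such a functional can take the value
    [1] on [x i] is the linear independence of the generators modulo
    products. *)
Lemma derivation (e : {scalar A}) : e 1 = 1 ->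
  (forall a, a \in gr_pos G -> e a = 0) ->
  exists f : {scalar A}, [/\ f (x i) = 1, f (x j) = 0
    & forall a b, f (a * b) = e a * f b + f a * e b].
Proof.
move=> e1 eG; have [xG x_indep _] := genx.
pose U := (1 + (gr_pos G * gr_pos G) + <[x j]>)%VS.
have xU : x i \notin U.
  apply/negP => /memv_addP [u /memv_addP [v /vlineP [l ->] [w wG2 ->]]].
  move=> [y /vlineP [m ->] xE].
  have wG : w \in gr_pos G by apply: (subvP (gr_pos_mul G)).
  have l0 : l = 0.
    have := congr1 e xE; rewrite eG // !linearD /= !linearZ /= e1.
    by rewrite (eG w) // (eG (x j)) // !mulr0 !addr0 mulr1.
  (* With [l = 0], [w = x i - m *: x j], a combination of the generators. *)
  pose c n : k := (n == i)%:R - m * (n == j)%:R.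
  have cE : \sum_n c n *: x n = w.
    rewrite (eq_bigr (fun n => (n == i)%:R *: x n - (m * (n == j)%:R) *: x n)).
      rewrite sumrB (bigD1 i) //= eqxx scale1r big1 => [|n /negbTE->]; last first.
        by rewrite scale0r.
      rewrite (bigD1 j) //= eqxx mulr1 big1 => [|n /negbTE->]; last first.
        by rewrite mulr0 scale0r.
      by rewrite !addr0 xE l0 scale0r add0r addrK.
    by move=> n _; rewrite scalerBl.
  have := x_indep c; rewrite cE => /(_ wG2 i) /eqP.
  by rewrite /c eqxx (negbTE neq_ij) mulr0 subr0 oner_eq0.
have [f f1 fU] := vspace_functional xU.
have f_one : f 1 = 0.
  by apply: fU; rewrite (subvP (addvSl _ _)) // (subvP (addvSl _ _)) // memv_line.
have f_sq a b : a \in gr_pos G -> b \in gr_pos G -> f (a * b) = 0.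
  move=> aG bG; apply: fU; rewrite (subvP (addvSl _ _)) //.
  by rewrite (subvP (addvSr _ _)) // memv_mul.
exists f; split=> // [|a b].
  by apply: fU; rewrite (subvP (addvSr _ _)) // memv_line.
have [l [a' aG ->]] := gr_decomp G a; have [m [b' bG ->]] := gr_decomp G b.
rewrite !mulrDl !mulrDr -!scalerAl !mul1r -!scalerAr mulr1.
rewrite !linearD /= !linearZ /= e1 f_one (eG a') // (eG b') // (f_sq a') //; ring.
Qed.

End Coordinates.

Theorem mainTheorem2 (k : fieldType) (A : falgType k)
  (G : connected_grading A) (nzG : gr_pos G != 0%VS)
  (r : nat) (x : 'I_r -> A) (genx : generators G x)
  (i j : 'I_r) (neq_ij : i != j)
  (xixj : x i * x j = 0) (xjxi : x j * x i = 0) :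
  ~ finite_dim (dsum (HH A)).
Proof.
have [e [e1 eG eM]] := augmentation G.
have [f [fi fj fM]] := derivation genx neq_ij e1 eG.
rewrite eq_sym in neq_ij.
have [g [gj gi gM]] := derivation genx neq_ij e1 eG.
have [xG _ _] := genx.
have fgM : (forall c a b, (if c then f else g) (a * b)
    = e a * (if c then f else g) b + (if c then f else g) a * e b).
  by case.
pose Q : square_zero_quotient A :=
  @SquareZeroQuotient k A e (fun c => if c then f else g) e1 eM fgM.
(* [true] stands for [x i], and [false] for [x j]. *)
pose y c := if c then x i else x j.
have yy b : y b * y (~~ b) = 0 by case: b.
have epsy b : eps Q (y b) = 0 by apply: eG; case: b; apply: xG.
have dery c b : der Q c (y b) = (c == b)%:R by case: c; case: b.
apply: dsum_infinite => b; exists b.*2.+1.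
  by rewrite -addnn -addnS leq_addr.
have ev : ~~ odd b.*2 by rewrite odd_double.
have [t [Phi [dt Phi0 Phi1]]] := nonbounding_cycle
  (@std_diffK _ (lself A))
  (fun u => (std_exact0 (M := lself A) (std_diff (lself A) 0 u)).2
              (ex_intro _ u erefl))
  (@cover_surj _ (lself A))
  (fun u => (std_exact0 (M := lself A) u).1)
  (fun p u => (std_exactS (M := lself A) (n := p) u).1)
  yy epsy dery ev.
exact: (homology_neq0 (C := tens_cpx (rself A) (std_resolution (lself A))) dt Phi0 Phi1).
Qed.
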